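(* Let $M=\big((S^3_q)^n,\hat\sigma^0_a,(\hat\sigma^0_a)^\ast\big)$ be a free $\sigma$-module and let $\nabla^0$ be a $q$-affine connection on $M$. Let $p:(S^3_q)^n\to(S^3_q)^n$ be a projection (a left $S^3_q$-module endomorphism with $p^2=p$), and set $\hat\sigma_a=p\circ\hat\sigma_a^0$ and $\hat\sigma_a^\ast=p\circ(\hat\sigma_a^0)^\ast$ for $a=1,2,3$. Then $\big(p(S^3_q)^n,\hat\sigma_a,\hat\sigma_a^\ast\big)$ (with these maps restricted to $p(S^3_q)^n$) is a $\sigma$-module, and $p\circ\nabla^0$, i.e. $(X,m)\mapsto p(\nabla^0_Xm)$ for $X\in TS^3_q$ and $m\in p(S^3_q)^n$, is a $q$-affine connection on $\big(p(S^3_q)^n,\hat\sigma_a,\hat\sigma_a^\ast\big)$.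
   Context: Let $q>0$ be real, $q\neq1$. $S^3_q$ is the unital complex $\ast$-algebra generated by $a,a^\ast,c,c^\ast$ with relations $ac=qca$, $c^\ast a^\ast=qa^\ast c^\ast$, $ac^\ast=qc^\ast a$, $ca^\ast=qa^\ast c$, $cc^\ast=c^\ast c$, $a^\ast a+c^\ast c=aa^\ast+q^2cc^\ast=1$. Coproduct: $\Delta(a)=a\otimes a-qc^\ast\otimes c$, $\Delta(c)=c\otimes a+a^\ast\otimes c$, $\Delta(a^\ast)=-qc\otimes c^\ast+a^\ast\otimes a^\ast$, $\Delta(c^\ast)=a\otimes c^\ast+c^\ast\otimes a^\ast$; counit $\epsilon(a)=\epsilon(a^\ast)=1$, $\epsilon(c)=\epsilon(c^\ast)=0$. $\mathcal U_q(\mathrm{su}(2))$ is the Hopf algebra generated by $E,F,K,K^{-1}$ with $K^{\pm1}E=q^{\pm1}EK^{\pm1}$, $K^{\pm1}F=q^{\mp1}FK^{\pm1}$, $[E,F]=(K^2-K^{-2})/(q-q^{-1})$, $\Delta(E)=E\otimes K+K^{-1}\otimes E$, $\Delta(F)=F\otimes K+K^{-1}\otimes F$, $\Delta(K^{\pm1})=K^{\pm1}\otimes K^{\pm1}$, $\epsilon(K)=1$, $\epsilon(E)=\epsilon(F)=0$. The unique Hopf pairing with $S^3_q$ has $\langle K^{\pm1},a\rangle=q^{\mp1/2}$, $\langle K^{\pm1},a^\ast\rangle=q^{\pm1/2}$, $\langle E,c\rangle=1$, $\langle F,c^\ast\rangle=-q^{-1}$, all other pairings of generators zero. It induces a left action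 $u\triangleright f=f_{(1)}\langle u,f_{(2)}\rangle$ and a right action $f\triangleleft u=\langle u,f_{(1)}\rangle f_{(2)}$ on $S^3_q$. Fix one of the two actions and write $u(f)$ for it. Put $X_1=X_+=\sqrt q\,EK$, $X_2=X_-=\frac1{\sqrt q}FK$, $X_3=X_z=\frac{1-K^4}{1-q^{-2}}$, acting on $S^3_q$; $\sigma_1=\sigma_2=K^2$, $\sigma_3=K^4$, $\sigma_1^\ast=\sigma_2^\ast=K^{-2}$, $\sigma_3^\ast=K^{-4}$ (algebra automorphisms of $S^3_q$). For a map $X:S^3_q\to S^3_q$ put $X^\ast(f)=(X(f^\ast))^\ast$. $TS^3_q$ is the complex vector space spanned by $X_a,X_a^\ast$, $a=1,2,3$. A $\sigma$-module is a left $S^3_q$-module $M$ with $\mathbb C$-linear maps $\hat\sigma_a,\hat\sigma_a^\ast:M\to M$ ($a=1,2,3$) with $\hat\sigma_a(fm)=\sigma_a(f)\hat\sigma_a(m)$, $\hat\sigma_a^\ast(fm)=\sigma_a^\ast(f)\hat\sigma_a^\ast(m)$ for $f\in S^3_q$, $m\in M$. A (left) $q$-affine connection on $M$ is a $\mathbb C$-bilinear map $\nabla:TS^3_q\times M\to M$, $(X,m)\mapsto\nabla_Xm$, such that $\nabla_{X_a}(fm)=f\nabla_{X_a}m+X_a(f)\hat\sigma_a(m)$ and $\nabla_{X_a^\ast}(fm)=\sigma_a^\ast(f)\nabla_{X_a^\ast}m+X_a^\ast(f)m$ for $a=1,2,3$, $f\in S^3_q$, $m\in M$. *)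

(* Defs.v *)
From HB Require Import structures.
From mathcomp Require Import all_boot all_order all_algebra.
From mathcomp Require Import generic_quotient complex.
From mathcomp Require Import boolp classical_sets functions reals.

Set Implicit Arguments.
Unset Strict Implicit.
Unset Printing Implicit Defensive.

Import Order.TTheory GRing.Theory Num.Theory.
Local Open Scope ring_scope.
Local Open Scope quotient_scope.

Section Presentation.
Variables (K : fieldType) (G : Type).

Inductive fterm : Type :=
| FConst of K
| FGen of G
| FAdd of fterm & fterm
| FMul of fterm & fterm.

HB.instance Definition _ := gen_eqMixin fterm.
HB.instance Definition _ := gen_choiceMixin fterm.

(* Noncommutative polynomial terms in the generators are identified by the
   least congruence making them a unital associative K-algebra in which the
   pairs related by rel become equal. *)
Inductive fcong (rel : fterm -> fterm -> Prop) : fterm -> fterm -> Prop :=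
| fcong_rel x y : rel x y -> fcong rel x y
| fcong_refl x : fcong rel x x
| fcong_sym x y : fcong rel x y -> fcong rel y x
| fcong_trans y x z : fcong rel x y -> fcong rel y z -> fcong rel x z
| fcong_add x x' y y' :
    fcong rel x x' -> fcong rel y y' -> fcong rel (FAdd x y) (FAdd x' y')
| fcong_mul x x' y y' :
    fcong rel x x' -> fcong rel y y' -> fcong rel (FMul x y) (FMul x' y')
| fcong_addA x y z : fcong rel (FAdd x (FAdd y z)) (FAdd (FAdd x y) z)
| fcong_addC x y : fcong rel (FAdd x y) (FAdd y x)
| fcong_add0 x : fcong rel (FAdd (FConst 0) x) x
| fcong_mul0 x : fcong rel (FMul (FConst 0) x) (FConst 0)
| fcong_mulA x y z : fcong rel (FMul x (FMul y z)) (FMul (FMul x y) z)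
| fcong_mul1l x : fcong rel (FMul (FConst 1) x) x
| fcong_mul1r x : fcong rel (FMul x (FConst 1)) x
| fcong_mulDl x y z :
    fcong rel (FMul (FAdd x y) z) (FAdd (FMul x z) (FMul y z))
| fcong_mulDr x y z :
    fcong rel (FMul x (FAdd y z)) (FAdd (FMul x y) (FMul x z))
| fcong_constD k l :
    fcong rel (FConst (k + l)) (FAdd (FConst k) (FConst l))
| fcong_constM k l :
    fcong rel (FConst (k * l)) (FMul (FConst k) (FConst l))
| fcong_constC k x : fcong rel (FMul (FConst k) x) (FMul x (FConst k)).

Section Quotient.
Variable rels : fterm -> fterm -> Prop.

Definition fcongb : rel fterm := fun x y => `[< fcong rels x y >].

Fact fcongb_refl : reflexive fcongb.
Proof. by move=> x; apply/asboolP; exact: fcong_refl. Qed.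

Fact fcongb_sym : symmetric fcongb.
Proof.
by move=> x y; apply/asboolP/asboolP => h; exact: fcong_sym.
Qed.

Fact fcongb_trans : transitive fcongb.
Proof.
move=> y x z /asboolP xy /asboolP yz; apply/asboolP.
exact: fcong_trans xy yz.
Qed.

Definition fcong_equiv := EquivRel fcongb fcongb_refl fcongb_sym fcongb_trans.

Definition presented := {eq_quot fcong_equiv}.

HB.instance Definition _ := Choice.on presented.
HB.instance Definition _ := Quotient.on presented.

Definition pclass (x : fterm) : presented := \pi_presented x.

Lemma pclassP x y : pclass x = pclass y <-> fcong rels x y.
Proof. by split=> [/eqmodP/asboolP|h] //; apply/eqmodP/asboolP. Qed.

Lemma pclassK (x : presented) : pclass (repr x) = x.
Proof. exact: reprK. Qed.

Lemma pclassW (P : presented -> Prop) :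
  (forall x, P (pclass x)) -> forall x, P x.
Proof. by move=> h x; rewrite -(pclassK x). Qed.

Definition padd (x y : presented) := pclass (FAdd (repr x) (repr y)).
Definition pmul (x y : presented) := pclass (FMul (repr x) (repr y)).
Definition popp (x : presented) := pclass (FMul (FConst (- 1)) (repr x)).
Definition pscale k (x : presented) := pclass (FMul (FConst k) (repr x)).

Lemma repr_pclass x : fcong rels (repr (pclass x)) x.
Proof. by apply/pclassP; rewrite pclassK. Qed.

Lemma paddE x y : padd (pclass x) (pclass y) = pclass (FAdd x y).
Proof. by apply/pclassP; apply: fcong_add; exact: repr_pclass. Qed.

Lemma pmulE x y : pmul (pclass x) (pclass y) = pclass (FMul x y).
Proof. by apply/pclassP; apply: fcong_mul; exact: repr_pclass. Qed.

Lemma pscaleE k x : pscale k (pclass x) = pclass (FMul (FConst k) x).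
Proof.
apply/pclassP; apply: fcong_mul; [exact: fcong_refl|exact: repr_pclass].
Qed.

Lemma poppE x : popp (pclass x) = pclass (FMul (FConst (- 1)) x).
Proof. exact: pscaleE. Qed.

Fact paddA : associative padd.
Proof.
move=> x y z; elim/pclassW: x => x; elim/pclassW: y => y.
elim/pclassW: z => z; rewrite !paddE; apply/pclassP; exact: fcong_addA.
Qed.

Fact paddC : commutative padd.
Proof.
move=> x y; elim/pclassW: x => x; elim/pclassW: y => y.
by rewrite !paddE; apply/pclassP; exact: fcong_addC.
Qed.

Fact padd0 : left_id (pclass (FConst 0)) padd.
Proof.
by elim/pclassW => x; rewrite paddE; apply/pclassP; exact: fcong_add0.
Qed.

Fact pmulA : associative pmul.
Proof.
move=> x y z; elim/pclassW: x => x; elim/pclassW: y => y.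
elim/pclassW: z => z; rewrite !pmulE; apply/pclassP; exact: fcong_mulA.
Qed.

Fact pmul1l : left_id (pclass (FConst 1)) pmul.
Proof.
by elim/pclassW => x; rewrite pmulE; apply/pclassP; exact: fcong_mul1l.
Qed.

Fact pmul1r : right_id (pclass (FConst 1)) pmul.
Proof.
by elim/pclassW => x; rewrite pmulE; apply/pclassP; exact: fcong_mul1r.
Qed.

Fact pmulDl : left_distributive pmul padd.
Proof.
move=> x y z; elim/pclassW: x => x; elim/pclassW: y => y; elim/pclassW: z => z.
by rewrite !(pmulE, paddE); apply/pclassP; exact: fcong_mulDl.
Qed.

Fact pmulDr : right_distributive pmul padd.
Proof.
move=> x y z; elim/pclassW: x => x; elim/pclassW: y => y; elim/pclassW: z => z.
by rewrite !(pmulE, paddE); apply/pclassP; exact: fcong_mulDr.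
Qed.

Lemma pscale_mul k x : pscale k x = pmul (pclass (FConst k)) x.
Proof. by elim/pclassW: x => x; rewrite pscaleE pmulE. Qed.

Lemma pconstD k l :
  pclass (FConst (k + l)) = padd (pclass (FConst k)) (pclass (FConst l)).
Proof. by rewrite paddE; apply/pclassP; exact: fcong_constD. Qed.

Lemma pconstM k l :
  pclass (FConst (k * l)) = pmul (pclass (FConst k)) (pclass (FConst l)).
Proof. by rewrite pmulE; apply/pclassP; exact: fcong_constM. Qed.

Lemma pconstC k x :
  pmul (pclass (FConst k)) x = pmul x (pclass (FConst k)).
Proof.
by elim/pclassW: x => x; rewrite !pmulE; apply/pclassP; exact: fcong_constC.
Qed.

Fact paddN : left_inverse (pclass (FConst 0)) popp padd.
Proof.
move=> x; have -> : popp x = pmul (pclass (FConst (- 1))) x.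
  by rewrite -pscale_mul.
rewrite -{2}(pmul1l x) -pmulDl -pconstD addNr -pscale_mul.
by elim/pclassW: x => x; rewrite pscaleE; apply/pclassP; exact: fcong_mul0.
Qed.

HB.instance Definition _ :=
  GRing.isZmodule.Build presented paddA paddC padd0 paddN.

HB.instance Definition _ :=
  GRing.Zmodule_isPzRing.Build presented
    pmulA pmul1l pmul1r pmulDl pmulDr.

Fact pscaleA k l x : pscale k (pscale l x) = pscale (k * l) x.
Proof. by rewrite !pscale_mul pconstM pmulA. Qed.

Fact pscale1 : left_id 1 pscale.
Proof. by move=> x; rewrite pscale_mul pmul1l. Qed.

Fact pscaleDr : right_distributive pscale +%R.
Proof. by move=> k x y; rewrite !pscale_mul; exact: pmulDr. Qed.

Fact pscaleDl x : {morph pscale^~ x : k l / k + l}.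
Proof. by move=> k l; rewrite !pscale_mul pconstD; exact: pmulDl. Qed.

HB.instance Definition _ :=
  GRing.Zmodule_isLmodule.Build K presented
    pscaleA pscale1 pscaleDr pscaleDl.

Fact presented_scalerAl k (x y : presented) : k *: (x * y) = (k *: x) * y.
Proof. by rewrite /GRing.scale /= !pscale_mul; exact: pmulA. Qed.

Fact presented_scalerAr k (x y : presented) : k *: (x * y) = x * (k *: y).
Proof.
rewrite /GRing.scale /= !pscale_mul [LHS]pmulA [pmul _ x]pconstC.
by rewrite -pmulA.
Qed.

Definition pgen (g : G) : presented := pclass (FGen g).

Lemma pclassD x y : pclass (FAdd x y) = pclass x + pclass y.
Proof. by rewrite -paddE. Qed.

Lemma pclassM x y : pclass (FMul x y) = pclass x * pclass y.
Proof. by rewrite -pmulE. Qed.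

Lemma pclassC k : pclass (FConst k) = k *: (1 : presented).
Proof. by rewrite /GRing.scale /= pscale_mul; exact/esym/pmul1r. Qed.

Section Lift.
Variables (A : pzRingType) (emb : {rmorphism K -> A}) (g : G -> A).

Fixpoint feval (t : fterm) : A :=
  match t with
  | FConst k => emb k
  | FGen i => g i
  | FAdd x y => feval x + feval y
  | FMul x y => feval x * feval y
  end.

(* The extension of g to the presented algebra; it is the algebra morphism of
   the universal property as soon as g satisfies the relations and emb is
   central. *)
Definition plift (x : presented) : A := feval (repr x).

Hypothesis embC : forall k x, emb k * x = x * emb k.
Hypothesis g_rels : forall x y, rels x y -> feval x = feval y.

Lemma feval_cong x y : fcong rels x y -> feval x = feval y.
Proof.
elim=> {x y} /=; rewrite ?rmorph0 ?rmorph1.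
- exact: g_rels.
- by [].
- by [].
- by move=> y x z _ -> _ ->.
- by move=> x x' y y' _ -> _ ->.
- by move=> x x' y y' _ -> _ ->.
- by move=> *; rewrite addrA.
- by move=> *; rewrite addrC.
- by move=> *; rewrite add0r.
- by move=> *; rewrite mul0r.
- by move=> *; rewrite mulrA.
- by move=> *; rewrite mul1r.
- by move=> *; rewrite mulr1.
- by move=> *; rewrite mulrDl.
- by move=> *; rewrite mulrDr.
- by move=> *; rewrite rmorphD.
- by move=> *; rewrite rmorphM.
- by move=> *; rewrite embC.
Qed.

Lemma pliftE x : plift (pclass x) = feval x.
Proof. exact/feval_cong/repr_pclass. Qed.

Lemma plift_gen i : plift (pgen i) = g i.
Proof. exact: pliftE. Qed.

Lemma plift_const k : plift (k *: (1 : presented)) = emb k.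
Proof. by rewrite -pclassC pliftE. Qed.

Lemma pliftB : {morph plift : x y / x - y}.
Proof.
move=> x y; elim/pclassW: x => x; elim/pclassW: y => y.
have -> : pclass x - pclass y = pclass (FAdd x (FMul (FConst (- 1)) y)).
  by rewrite pclassD pclassM pclassC -presented_scalerAl mul1r scaleN1r.
by rewrite !pliftE /= rmorphN rmorph1 mulN1r.
Qed.

Lemma pliftM : monoid_morphism plift.
Proof.
split=> [|x y]; first by rewrite -(scale1r (1 : presented)) plift_const rmorph1.
by elim/pclassW: x => x; elim/pclassW: y => y; rewrite -pclassM !pliftE.
Qed.

End Lift.
End Quotient.
End Presentation.

Arguments FConst {K G} _%_ring_scope.
Arguments FGen {K G} _.

Declare Scope fterm_scope.
Delimit Scope fterm_scope with F.
Bind Scope fterm_scope with fterm.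
Arguments FAdd {K G} _%_F _%_F.
Arguments FMul {K G} _%_F _%_F.

Notation "x + y" := (FAdd x y) : fterm_scope.
Notation "x * y" := (FMul x y) : fterm_scope.
Notation "k %:F" := (FConst k) : fterm_scope.

Section TensorModule.
Variables (K : fieldType) (A B : lmodType K).

(* A sequence of pairs is the formal sum of the corresponding pure tensors. *)
Inductive tcong : seq (A * B) -> seq (A * B) -> Prop :=
| tcong_refl s : tcong s s
| tcong_sym s t : tcong s t -> tcong t s
| tcong_trans t s u : tcong s t -> tcong t u -> tcong s u
| tcong_cat s s' t t' :
    tcong s s' -> tcong t t' -> tcong (s ++ t) (s' ++ t')
| tcong_catC s t : tcong (s ++ t) (t ++ s)
| tcong_Dl a a' b : tcong [:: (a + a', b)] [:: (a, b); (a', b)]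
| tcong_Dr a b b' : tcong [:: (a, b + b')] [:: (a, b); (a, b')]
| tcong_Z k a b : tcong [:: (k *: a, b)] [:: (a, k *: b)]
| tcong_0 b : tcong [:: (0, b)] [::].

Definition tcongb : rel (seq (A * B)) := fun s t => `[< tcong s t >].

Fact tcongb_refl : reflexive tcongb.
Proof. by move=> x; apply/asboolP; exact: tcong_refl. Qed.

Fact tcongb_sym : symmetric tcongb.
Proof. by move=> x y; apply/asboolP/asboolP => h; exact: tcong_sym. Qed.

Fact tcongb_trans : transitive tcongb.
Proof.
move=> y x z /asboolP xy /asboolP yz; apply/asboolP.
exact: tcong_trans xy yz.
Qed.

Definition tcong_equiv := EquivRel tcongb tcongb_refl tcongb_sym tcongb_trans.

Definition tensor := {eq_quot tcong_equiv}.

HB.instance Definition _ := Choice.on tensor.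
HB.instance Definition _ := Quotient.on tensor.

Definition tclass (s : seq (A * B)) : tensor := \pi_tensor s.

Lemma tclassP s t : tclass s = tclass t <-> tcong s t.
Proof. by split=> [/eqmodP/asboolP|h] //; apply/eqmodP/asboolP. Qed.

Lemma tclassW (P : tensor -> Prop) :
  (forall s, P (tclass s)) -> forall x, P x.
Proof. by move=> h x; rewrite -(reprK x); exact: h. Qed.

Lemma repr_tclass s : tcong (repr (tclass s)) s.
Proof. by apply/tclassP; exact: reprK. Qed.

Definition tscale_pair k (x : A * B) := (k *: x.1, x.2).

Definition tadd (x y : tensor) := tclass (repr x ++ repr y).
Definition tscale k (x : tensor) := tclass (map (tscale_pair k) (repr x)).
Definition topp (x : tensor) := tscale (- 1) x.

Lemma taddE s t : tadd (tclass s) (tclass t) = tclass (s ++ t).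
Proof. by apply/tclassP; apply: tcong_cat; exact: repr_tclass. Qed.

Lemma tcong_scale k s t : tcong s t ->
  tcong (map (tscale_pair k) s) (map (tscale_pair k) t).
Proof.
elim=> {s t} /=.
- by move=> s; exact: tcong_refl.
- by move=> s t _; exact: tcong_sym.
- by move=> t s u _ h _; exact: tcong_trans h.
- by move=> s s' t t' _ h _ h'; rewrite !map_cat; exact: tcong_cat.
- by move=> s t; rewrite !map_cat; exact: tcong_catC.
- by move=> a a' b; rewrite /tscale_pair /= scalerDr; exact: tcong_Dl.
- by move=> a b b'; exact: tcong_Dr.
- move=> l a b; rewrite /tscale_pair /= scalerA mulrC -scalerA.
  exact: tcong_Z.
- by move=> b; rewrite /tscale_pair /= scaler0; exact: tcong_0.
Qed.

Lemma tscaleE k s : tscale k (tclass s) = tclass (map (tscale_pair k) s).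
Proof. by apply/tclassP/tcong_scale; exact: repr_tclass. Qed.

Fact taddA : associative tadd.
Proof.
move=> x y z; elim/tclassW: x => x; elim/tclassW: y => y.
by elim/tclassW: z => z; rewrite !taddE catA.
Qed.

Fact taddC : commutative tadd.
Proof.
move=> x y; elim/tclassW: x => x; elim/tclassW: y => y.
by rewrite !taddE; apply/tclassP; exact: tcong_catC.
Qed.

Fact tadd0 : left_id (tclass [::]) tadd.
Proof. by elim/tclassW => x; rewrite taddE. Qed.

Fact tscaleDl x k l : tscale (k + l) x = tadd (tscale k x) (tscale l x).
Proof.
elim/tclassW: x => s; rewrite !tscaleE.
elim: s => [|[a b] s IHs] /=; first by rewrite taddE.
rewrite -(cat1s _ (map _ s)) -taddE IHs.
rewrite -(cat1s _ (map (tscale_pair k) s)) -(cat1s _ (map (tscale_pair l) s)).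
rewrite -!taddE -!taddA; have -> : tclass [:: tscale_pair (k + l) (a, b)] =
    tadd (tclass [:: tscale_pair k (a, b)]) (tclass [:: tscale_pair l (a, b)]).
  by rewrite taddE; apply/tclassP; rewrite /tscale_pair scalerDl; exact: tcong_Dl.
rewrite -!taddA; congr tadd; rewrite !taddA; congr tadd; exact: taddC.
Qed.

Fact tscale0 x : tscale 0 x = tclass [::].
Proof.
elim/tclassW: x => s; rewrite tscaleE.
elim: s => [|[a b] s IHs] //=; rewrite -cat1s -taddE IHs taddE /=.
by apply/tclassP; rewrite /tscale_pair scale0r; exact: tcong_0.
Qed.

Fact tscale1 : left_id 1 tscale.
Proof.
elim/tclassW => s; rewrite tscaleE; congr tclass; elim: s => //= -[a b] s ->.
by rewrite /tscale_pair scale1r.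
Qed.

Fact taddN : left_inverse (tclass [::]) topp tadd.
Proof.
by move=> x; rewrite -{2}[x]tscale1 -tscaleDl addNr tscale0.
Qed.

HB.instance Definition _ :=
  GRing.isZmodule.Build tensor taddA taddC tadd0 taddN.

Fact tscaleA k l x : tscale k (tscale l x) = tscale (k * l) x.
Proof.
elim/tclassW: x => s; rewrite !tscaleE -map_comp; congr tclass.
by apply: eq_map => -[a b]; rewrite /tscale_pair /= scalerA.
Qed.

Fact tscaleDr : right_distributive tscale +%R.
Proof.
move=> k x y; elim/tclassW: x => x; elim/tclassW: y => y.
by rewrite /GRing.add /= !(taddE, tscaleE) map_cat.
Qed.

HB.instance Definition _ :=
  GRing.Zmodule_isLmodule.Build K tensor tscaleA tscale1 tscaleDr
    (fun x k l => tscaleDl x k l).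

Definition tens (a : A) (b : B) : tensor := tclass [:: (a, b)].

Lemma tclass_sum s : tclass s = \sum_(x <- s) tens x.1 x.2.
Proof.
elim: s => [|[a b] s IHs]; first by rewrite big_nil.
by rewrite big_cons -IHs -cat1s -taddE.
Qed.

Lemma tensDl a a' b : tens (a + a') b = tens a b + tens a' b.
Proof. by rewrite [RHS]taddE; apply/tclassP; exact: tcong_Dl. Qed.

Lemma tensDr a b b' : tens a (b + b') = tens a b + tens a b'.
Proof. by rewrite [RHS]taddE; apply/tclassP; exact: tcong_Dr. Qed.

Lemma tensZl k a b : tens (k *: a) b = k *: tens a b.
Proof. by rewrite [RHS]tscaleE. Qed.

Lemma tensZr k a b : tens a (k *: b) = k *: tens a b.
Proof. by rewrite -tensZl; apply/tclassP/tcong_sym; exact: tcong_Z. Qed.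

(* sweedler phi t is the sum of phi t_(1) t_(2), where t is the sum of the
   t_(1) (x) t_(2); for bilinear phi it does not depend on the chosen
   expression of t, see sweedlerE. *)
Definition sweedler (V : nmodType) (phi : A -> B -> V) (t : tensor) : V :=
  \sum_(x <- repr t) phi x.1 x.2.

Section SweedlerTheory.
Variables (V : lmodType K) (phi : A -> B -> V).
Hypothesis phi_linl : forall b, linear (phi^~ b).
Hypothesis phi_linr : forall a, linear (phi a).

Let phiDl a a' b : phi (a + a') b = phi a b + phi a' b.
Proof. by have := phi_linl b 1 a a'; rewrite !scale1r. Qed.

Let phiDr a b b' : phi a (b + b') = phi a b + phi a b'.
Proof. by have := phi_linr a 1 b b'; rewrite !scale1r. Qed.

Let phi0l b : phi 0 b = 0.
Proof. by apply: (addrI (phi 0 b)); rewrite -phiDl !addr0. Qed.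

Let phi0r a : phi a 0 = 0.
Proof. by apply: (addrI (phi a 0)); rewrite -phiDr !addr0. Qed.

Let phiZ k a b : phi (k *: a) b = phi a (k *: b).
Proof.
have := phi_linl b k a 0; rewrite phi0l !addr0 => ->.
by have := phi_linr a k b 0; rewrite phi0r !addr0 => ->.
Qed.

Lemma sweedler_tclass s :
  sweedler phi (tclass s) = \sum_(x <- s) phi x.1 x.2.
Proof.
rewrite /sweedler; move: (repr (tclass s)) (repr_tclass s) => s'.
elim=> {s s'} //=.
- by move=> s t u _ -> _ ->.
- by move=> s s' t t' _ h _ h'; rewrite !big_cat /= h h'.
- by move=> s t; rewrite !big_cat /= addrC.
- by move=> a a' b; rewrite !big_cons !big_nil /= phiDl !addr0.
- by move=> a b b'; rewrite !big_cons !big_nil /= phiDr !addr0.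
- by move=> k a b; rewrite !big_cons !big_nil /= phiZ.
- by move=> b; rewrite big_cons !big_nil /= phi0l addr0.
Qed.

Lemma sweedlerE a b : sweedler phi (tens a b) = phi a b.
Proof. by rewrite sweedler_tclass big_seq1. Qed.

Lemma sweedler_linear : linear (sweedler phi).
Proof.
move=> k x y; elim/tclassW: x => x; elim/tclassW: y => y.
have -> : k *: tclass x + tclass y = tclass (map (tscale_pair k) x ++ y).
  by rewrite /GRing.add /GRing.scale /= tscaleE taddE.
rewrite !sweedler_tclass big_cat big_map /= scaler_sumr; congr (_ + _).
apply: eq_bigr => -[a b] _ /=.
by have := phi_linl b k a 0; rewrite phi0l !addr0.
Qed.

End SweedlerTheory.
End TensorModule.

Arguments sweedler {K A B V} phi t.

Notation "A \ox B" := (tensor A B) (at level 40, left associativity) : type_scope.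
Notation "a \ox b" := (tens a b) (at level 40, left associativity) : ring_scope.

Section TensorAlgebra.
Variables (K : fieldType) (A B : algType K).
Notation T := (tensor A B).

Definition tmul_seq (s t : seq (A * B)) : seq (A * B) :=
  [seq (x.1 * y.1, x.2 * y.2) | x <- s, y <- t].

Definition tmul (x y : T) : T := tclass (tmul_seq (repr x) (repr y)).

Lemma tmul_seqE s t : tclass (tmul_seq s t) =
  \sum_(x <- s) \sum_(y <- t) (x.1 * y.1) \ox (x.2 * y.2).
Proof. by rewrite tclass_sum big_allpairs_dep. Qed.

Lemma tmulE s t : tmul (tclass s) (tclass t) =
  \sum_(x <- s) \sum_(y <- t) (x.1 * y.1) \ox (x.2 * y.2).
Proof.
rewrite /tmul tmul_seqE.
transitivity (\sum_(x <- s) \sum_(y <- repr (tclass t))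
    (x.1 * y.1) \ox (x.2 * y.2)).
  pose phi (a : A) (b : B) : T :=
    \sum_(y <- repr (tclass t)) (a * y.1) \ox (b * y.2).
  apply: (@sweedler_tclass _ _ _ _ phi) => [b k a a'|a k b b'].
    rewrite /phi scaler_sumr -big_split /=; apply: eq_bigr => y _.
    by rewrite mulrDl -scalerAl tensDl tensZl.
  rewrite /phi scaler_sumr -big_split /=; apply: eq_bigr => y _.
  by rewrite mulrDl -scalerAl tensDr tensZr.
apply: eq_bigr => x _.
pose phi (a : A) (b : B) : T := (x.1 * a) \ox (x.2 * b).
apply: (@sweedler_tclass _ _ _ _ phi) => [b k a a'|a k b b'].
  by rewrite /phi mulrDr -scalerAr tensDl tensZl.
by rewrite /phi mulrDr -scalerAr tensDr tensZr.
Qed.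

Fact tmulDl : left_distributive tmul +%R.
Proof.
move=> x y z; elim/tclassW: x => x; elim/tclassW: y => y; elim/tclassW: z => z.
have -> : tclass x + tclass y = tclass (x ++ y) by exact: taddE.
by rewrite !tmulE big_cat.
Qed.

Fact tmulDr : right_distributive tmul +%R.
Proof.
move=> x y z; elim/tclassW: x => x; elim/tclassW: y => y; elim/tclassW: z => z.
have -> : tclass y + tclass z = tclass (y ++ z) by exact: taddE.
rewrite !tmulE -big_split; apply: eq_bigr => u _; exact: big_cat.
Qed.

Lemma tmul_tens a b a' b' : tmul (a \ox b) (a' \ox b') = (a * a') \ox (b * b').
Proof. by rewrite tmulE !big_seq1. Qed.

Let tmul_suml (I : Type) (r : seq I) (F : I -> T) y :
  tmul (\sum_(i <- r) F i) y = \sum_(i <- r) tmul (F i) y.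
Proof.
elim: r => [|i r IHr]; last by rewrite !big_cons tmulDl IHr.
by rewrite !big_nil; apply: (addrI (tmul 0 y)); rewrite -tmulDl !addr0.
Qed.

Let tmul_sumr (I : Type) (r : seq I) (F : I -> T) x :
  tmul x (\sum_(i <- r) F i) = \sum_(i <- r) tmul x (F i).
Proof.
elim: r => [|i r IHr]; last by rewrite !big_cons tmulDr IHr.
by rewrite !big_nil; apply: (addrI (tmul x 0)); rewrite -tmulDr !addr0.
Qed.

Fact tmulA : associative tmul.
Proof.
move=> x y z; elim/tclassW: x => x; elim/tclassW: y => y; elim/tclassW: z => z.
rewrite (tclass_sum x) !tmul_suml; apply: eq_bigr => u _.
rewrite (tclass_sum y) tmul_suml !tmul_sumr tmul_suml; apply: eq_bigr => v _.
rewrite (tclass_sum z) !tmul_sumr; apply: eq_bigr => w _.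
by rewrite !tmul_tens !mulrA.
Qed.

Fact tmul1l : left_id (1 \ox 1 : T) tmul.
Proof.
elim/tclassW => x; rewrite tclass_sum tmul_sumr; apply: eq_bigr => u _.
by rewrite tmul_tens !mul1r.
Qed.

Fact tmul1r : right_id (1 \ox 1 : T) tmul.
Proof.
elim/tclassW => x; rewrite tclass_sum tmul_suml; apply: eq_bigr => u _.
by rewrite tmul_tens !mulr1.
Qed.

HB.instance Definition _ :=
  GRing.Zmodule_isPzRing.Build T tmulA tmul1l tmul1r tmulDl tmulDr.

Lemma tensM a b a' b' : (a \ox b : T) * (a' \ox b') = (a * a') \ox (b * b').
Proof. exact: tmul_tens. Qed.

Lemma tensor_scalerAl k (x y : T) : k *: (x * y) = (k *: x) * y.
Proof.
elim/tclassW: x => x; elim/tclassW: y => y; rewrite !tclass_sum.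
rewrite scaler_sumr !mulr_suml scaler_sumr; apply: eq_bigr => u _.
rewrite !mulr_sumr scaler_sumr; apply: eq_bigr => v _.
by rewrite -tensZl !tensM -scalerAl tensZl.
Qed.

Lemma tensor_scalerAr k (x y : T) : k *: (x * y) = x * (k *: y).
Proof.
elim/tclassW: x => x; elim/tclassW: y => y; rewrite !tclass_sum.
rewrite scaler_sumr !mulr_suml scaler_sumr; apply: eq_bigr => u _.
rewrite !mulr_sumr scaler_sumr; apply: eq_bigr => v _.
by rewrite -tensZl !tensM -scalerAr tensZl.
Qed.

Definition tconst (k : K) : T := k *: (1 : T).

Fact tconst_is_additive : zmod_morphism tconst.
Proof. by move=> k l; rewrite /tconst scalerBl. Qed.

Fact tconst_is_monoid : monoid_morphism tconst.
Proof.
split=> [|k l]; rewrite /tconst ?scale1r //.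
by rewrite -tensor_scalerAl mul1r scalerA.
Qed.

HB.instance Definition _ :=
  GRing.isZmodMorphism.Build K T tconst tconst_is_additive.
HB.instance Definition _ :=
  GRing.isMonoidMorphism.Build K T tconst tconst_is_monoid.

Lemma tconstE k x : tconst k * x = k *: x.
Proof. by rewrite -tensor_scalerAl mul1r. Qed.

Lemma tconstC k x : tconst k * x = x * tconst k.
Proof. by rewrite tconstE -tensor_scalerAr mulr1. Qed.

End TensorAlgebra.

Section CoproductRelations.
Variables (K : fieldType) (A : algType K) (q : K).

Let tensNl (u w : A) : (- u) \ox w = - (u \ox w).
Proof. by rewrite -scaleN1r tensZl scaleN1r. Qed.

Let tensNr (u w : A) : w \ox (- u) = - (w \ox u).
Proof. by rewrite -scaleN1r tensZr scaleN1r. Qed.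

Lemma sphere_coproduct_relations (a as_ c cs : A)
    (Da := a \ox a - q *: (cs \ox c)) (Dc := c \ox a + as_ \ox c)
    (Das := as_ \ox as_ - q *: (c \ox cs)) (Dcs := a \ox cs + cs \ox as_) :
  a * c = q *: (c * a) -> cs * as_ = q *: (as_ * cs) ->
  a * cs = q *: (cs * a) -> c * as_ = q *: (as_ * c) -> c * cs = cs * c ->
  as_ * a + cs * c = 1 -> a * as_ + q ^+ 2 *: (c * cs) = 1 ->
  [/\ Da * Dc = q *: (Dc * Da) /\ Dcs * Das = q *: (Das * Dcs),
      Da * Dcs = q *: (Dcs * Da) /\ Dc * Das = q *: (Das * Dc),
      Dc * Dcs = Dcs * Dc, Das * Da + Dcs * Dc = 1
    & Da * Das + q ^+ 2 *: (Dc * Dcs) = 1].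
Proof.
rewrite /Da /Dc /Das /Dcs {Da Dc Das Dcs} => ac csas acs cas ccs asa0 aas0.
have aas : a * as_ = 1 - q ^+ 2 *: (cs * c) by rewrite -aas0 ccs addrK.
have asa : as_ * a = 1 - cs * c by rewrite -asa0 addrK.
(do 2?split); rewrite ?(mulrDl, mulrDr, mulNr, mulrN, opprK).
all: rewrite -?tensor_scalerAl -?tensor_scalerAr ?tensM.
all: rewrite ?(ac, csas, acs, cas, ccs, aas, asa).
all: rewrite ?(tensDl, tensDr, tensNl, tensNr, tensZl, tensZr).
all: rewrite ?(scalerDr, scalerN, scalerA, opprD, opprK).
all: rewrite ?(expr2 q) ?(mulrA q) ?addrA.
- by rewrite [RHS](ACl (1*3*2*4*5))/=.
- by rewrite [RHS](ACl (1*5*4*3*2))/=.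
- by rewrite [RHS](ACl (1*3*2*4*5))/=.
- by rewrite [RHS](ACl (1*5*4*3*2))/=.
- by rewrite [RHS](ACl (1*4*3*2*5*6))/=.
- by rewrite [LHS](ACl (1*9*2*11*3*4*12*13*5*8*6*7*10))/= !addrK.
- by rewrite [LHS](ACl (1*11*2*9*3*4*10*8*5*13*6*7*12))/= !addrK.
Qed.

Lemma enveloping_coproduct_relations (E F G Gi : A)
    (DE := E \ox G + Gi \ox E) (DF := F \ox G + Gi \ox F)
    (DG := G \ox G) (DGi := Gi \ox Gi) : q != 0 ->
  G * Gi = 1 -> Gi * G = 1 ->
  G * E = q *: (E * G) -> Gi * E = q^-1 *: (E * Gi) ->
  G * F = q^-1 *: (F * G) -> Gi * F = q *: (F * Gi) ->
  E * F - F * E = (q - q^-1)^-1 *: (G * G - Gi * Gi) ->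
  [/\ DG * DGi = 1 /\ DGi * DG = 1,
      DG * DE = q *: (DE * DG) /\ DGi * DE = q^-1 *: (DE * DGi),
      DG * DF = q^-1 *: (DF * DG) /\ DGi * DF = q *: (DF * DGi)
    & DE * DF - DF * DE = (q - q^-1)^-1 *: (DG * DG - DGi * DGi)].
Proof.
rewrite /DE /DF /DG /DGi {DE DF DG DGi} => q0 GGi GiG GE GiE GF GiF EF0.
have EF : E * F = F * E + (q - q^-1)^-1 *: (G * G - Gi * Gi).
  by rewrite -EF0 addrC subrK.
split; first split; first by rewrite tensM GGi.
- by rewrite tensM GiG.
- split; rewrite !(mulrDl, mulrDr, tensM, GE, GiE) GGi GiG.
  by rewrite !(tensZl, tensZr, scalerDr).
  by rewrite !(tensZl, tensZr, scalerDr).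
- split; rewrite !(mulrDl, mulrDr, tensM, GF, GiF) GGi GiG.
  by rewrite !(tensZl, tensZr, scalerDr).
  by rewrite !(tensZl, tensZr, scalerDr).
rewrite !(mulrDl, mulrDr) !tensM !(GE, GiE, GF, GiF, EF).
rewrite !(tensZl, tensZr, scalerA, mulVf q0, mulfV q0, scale1r).
rewrite ?(tensDl, tensDr, tensNl, tensNr, tensZl, tensZr).
rewrite ?(scalerDr, scalerN, opprD, opprK) !addrA.
by rewrite [LHS](ACl (2*8*1*9*4*11*5*10*6*12*7*3))/= !addrK.
Qed.

End CoproductRelations.

Record qparam (R : realType) := QParam {
  qval :> R;
  qval_gt0 : 0 < qval;
  qval_neq1 : qval != 1
}.

Section QParam.
Variables (R : realType) (q : qparam R).

Definition qC : R[i] := (qval q)%:C%C.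
Definition sqrtq : R[i] := (Num.sqrt (qval q))%:C%C.

Lemma qC_neq0 : qC != 0.
Proof. by rewrite /qC fmorph_eq0 gt_eqF // qval_gt0. Qed.

Lemma conj_qC : qC^* = qC.
Proof. by rewrite /qC; apply: conj_Creal; rewrite complex_real. Qed.

End QParam.

Lemma pclassZ (K : fieldType) (G : Type) (rels : fterm K G -> fterm K G -> Prop)
  (k : K) (x : fterm K G) :
  pclass rels (k%:F * x)%F = k *: pclass rels x.
Proof. by rewrite pclassM pclassC -presented_scalerAl mul1r. Qed.

Section QuantumSphere.
Variables (R : realType) (q : qparam R).
Notation C := R[i].
Notation qq := (qC q).

(* Gas and Gcs stand for a^* and c^*. *)
Inductive S3gen := Ga | Gas | Gc | Gcs.

Local Notation "'a" := (FGen Ga) (at level 0) : fterm_scope.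
Local Notation "'as" := (FGen Gas) (at level 0) : fterm_scope.
Local Notation "'c" := (FGen Gc) (at level 0) : fterm_scope.
Local Notation "'cs" := (FGen Gcs) (at level 0) : fterm_scope.

Inductive S3rel : fterm C S3gen -> fterm C S3gen -> Prop :=
| S3rel_ac : S3rel ('a * 'c)%F (qq%:F * ('c * 'a))%F
| S3rel_csas : S3rel ('cs * 'as)%F (qq%:F * ('as * 'cs))%F
| S3rel_acs : S3rel ('a * 'cs)%F (qq%:F * ('cs * 'a))%F
| S3rel_cas : S3rel ('c * 'as)%F (qq%:F * ('as * 'c))%F
| S3rel_ccs : S3rel ('c * 'cs)%F ('cs * 'c)%F
| S3rel_asa : S3rel ('as * 'a + 'cs * 'c)%F 1%:F
| S3rel_aas : S3rel ('a * 'as + (qq ^+ 2)%:F * ('c * 'cs))%F 1%:F.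

Definition S3counit_gen (x : S3gen) : C :=
  match x with Ga | Gas => 1 | Gc | Gcs => 0 end.

Lemma S3counit_rel x y : S3rel x y ->
  feval (idfun : {rmorphism C -> C}) S3counit_gen x =
  feval (idfun : {rmorphism C -> C}) S3counit_gen y.
Proof.
by case=> /=; rewrite ?(mulr0, mul0r, mulr1, mul1r, addr0).
Qed.

Definition S3 : Type := presented S3rel.
HB.instance Definition _ := GRing.PzRing.on S3.
HB.instance Definition _ := GRing.Lmodule.copy S3 (presented S3rel).

Definition S3counit (f : S3) : C := plift (idfun : {rmorphism C -> C}) S3counit_gen f.

Fact S3_oner_neq0 : (1 : S3) != 0.
Proof.
have embC (k x : C) : (idfun : {rmorphism C -> C}) k * x = x * idfun k.
  exact: mulrC.
have [h1 _] := pliftM embC S3counit_rel.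
apply/eqP => e; move: (pliftB embC S3counit_rel 0 0).
rewrite subrr subrr -[X in plift _ _ X]e h1 => /eqP.
by rewrite oner_eq0.
Qed.

HB.instance Definition _ :=
  GRing.PzSemiRing_isNonZero.Build S3 S3_oner_neq0.
HB.instance Definition _ :=
  GRing.Lmodule_isLalgebra.Build C S3 (@presented_scalerAl C S3gen S3rel).
HB.instance Definition _ :=
  GRing.Lalgebra_isAlgebra.Build C S3 (@presented_scalerAr C S3gen S3rel).

Definition S3of (x : S3gen) : S3 := pgen S3rel x.

Local Notation a := (S3of Ga).
Local Notation as_ := (S3of Gas).
Local Notation c := (S3of Gc).
Local Notation cs := (S3of Gcs).

Let S3relE x y : S3rel x y -> pclass S3rel x = pclass S3rel y.
Proof. by move=> h; apply/pclassP/fcong_rel. Qed.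

Lemma S3_ac : a * c = qq *: (c * a).
Proof. by have := S3relE S3rel_ac; rewrite pclassZ !pclassM. Qed.

Lemma S3_csas : cs * as_ = qq *: (as_ * cs).
Proof. by have := S3relE S3rel_csas; rewrite pclassZ !pclassM. Qed.

Lemma S3_acs : a * cs = qq *: (cs * a).
Proof. by have := S3relE S3rel_acs; rewrite pclassZ !pclassM. Qed.

Lemma S3_cas : c * as_ = qq *: (as_ * c).
Proof. by have := S3relE S3rel_cas; rewrite pclassZ !pclassM. Qed.

Lemma S3_ccs : c * cs = cs * c.
Proof. by have := S3relE S3rel_ccs; rewrite !pclassM. Qed.

Lemma S3_asa : as_ * a + cs * c = 1.
Proof.
by have := S3relE S3rel_asa; rewrite pclassD !pclassM pclassC scale1r.
Qed.

Lemma S3_aas : a * as_ + qq ^+ 2 *: (c * cs) = 1.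
Proof.
by have := S3relE S3rel_aas; rewrite pclassD pclassZ !pclassM pclassC scale1r.
Qed.

(* The involution is the antilinear extension of a <-> a*, c <-> c* to a ring
   morphism into the opposite ring S3^c. *)
Definition S3star_gen (x : S3gen) : S3^c :=
  match x with Ga => as_ | Gas => a | Gc => cs | Gcs => c end.

Definition S3conj_const (k : C) : S3^c := k^* *: (1 : S3).

Fact S3conj_const_is_additive : zmod_morphism S3conj_const.
Proof. by move=> k l; rewrite /S3conj_const rmorphB scalerBl. Qed.

Fact S3conj_const_is_monoid : monoid_morphism S3conj_const.
Proof.
split=> [|k l]; rewrite /S3conj_const ?rmorph1 ?scale1r //.
rewrite rmorphM; change (k^* * l^* *: (1 : S3) = (l^* *: 1) * (k^* *: 1)).
by rewrite -scalerAl mul1r scalerA mulrC.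
Qed.

HB.instance Definition _ :=
  GRing.isZmodMorphism.Build C S3^c S3conj_const S3conj_const_is_additive.
HB.instance Definition _ :=
  GRing.isMonoidMorphism.Build C S3^c S3conj_const S3conj_const_is_monoid.

Definition S3star (f : S3) : S3 :=
  plift (S3conj_const : {rmorphism C -> S3^c}) S3star_gen f.

Lemma S3star_constC (k : C) (x : S3^c) :
  S3conj_const k * x = x * S3conj_const k.
Proof.
change ((x : S3) * (k^* *: 1) = (k^* *: 1) * (x : S3)).
by rewrite -scalerAl -scalerAr mulr1 mul1r.
Qed.

Lemma S3star_rel x y : S3rel x y ->
  feval S3conj_const S3star_gen x = feval S3conj_const S3star_gen y.
Proof.
have mE (u v : S3) : (u : S3^c) * (v : S3^c) = v * u :> S3 by [].
have cE k (u : S3) : (S3conj_const k : S3^c) * (u : S3^c) = k^* *: u :> S3.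
  by rewrite mE -scalerAr mulr1.
have dE (u v : S3) : (u : S3^c) + (v : S3^c) = u + v :> S3 by [].
have qE : qq^* = qq by exact: conj_qC.
case=> /=; rewrite ?dE ?cE ?mE ?rmorphXn /= ?qE.
- exact: S3_csas.
- exact: S3_ac.
- exact: S3_cas.
- exact: S3_acs.
- exact: S3_ccs.
- by rewrite S3_asa rmorph1.
- by rewrite S3_aas rmorph1.
Qed.

Lemma S3starM : {morph S3star : f g / f * g >-> g * f}.
Proof. exact: (pliftM S3star_constC S3star_rel).2. Qed.

Lemma S3starB : {morph S3star : f g / f - g}.
Proof. exact: (pliftB S3star_constC S3star_rel). Qed.

Lemma S3star_gens x : S3star (S3of x) = S3star_gen x.
Proof. exact: (plift_gen S3star_constC S3star_rel). Qed.

Lemma S3starZ k f : S3star (k *: f) = k^* *: S3star f.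
Proof.
rewrite -{1}(mul1r f) scalerAl S3starM.
by rewrite /S3star (plift_const S3star_constC S3star_rel) -scalerAr mulr1.
Qed.

Lemma S3starK : involutive S3star.
Proof.
have s1 : S3star 1 = 1 by exact: (pliftM S3star_constC S3star_rel).1.
elim/pclassW; elim=> [k|x|x IHx y IHy|x IHx y IHy].
- by rewrite pclassC !S3starZ !s1 conjCK.
- by rewrite -/(S3of x) S3star_gens; case: x; rewrite S3star_gens.
- have starN (f : S3) : S3star (- f) = - S3star f.
    by rewrite -scaleN1r S3starZ rmorphN rmorph1 scaleN1r.
  rewrite pclassD -[pclass _ y]opprK S3starB starN S3starB starN.
  by rewrite [S3star (S3star _)]IHx [S3star (S3star _)]IHy.
- by rewrite pclassM !S3starM [S3star (S3star _)]IHx [S3star (S3star _)]IHy.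
Qed.

Definition S3cop_gen (x : S3gen) : S3 \ox S3 :=
  match x with
  | Ga => a \ox a - qq *: (cs \ox c)
  | Gc => c \ox a + as_ \ox c
  | Gas => as_ \ox as_ - qq *: (c \ox cs)
  | Gcs => a \ox cs + cs \ox as_
  end.

Definition S3cop (f : S3) : S3 \ox S3 :=
  plift (@tconst C S3 S3 : {rmorphism C -> S3 \ox S3}) S3cop_gen f.

Lemma S3cop_rel x y : S3rel x y ->
  feval (@tconst C S3 S3) S3cop_gen x = feval (@tconst C S3 S3) S3cop_gen y.
Proof.
have [[h1 h2] [h3 h4] h5 h6 h7] :=
  sphere_coproduct_relations S3_ac S3_csas S3_acs S3_cas S3_ccs S3_asa S3_aas.
by case; rewrite /= ?tconstE ?rmorph1.
Qed.

Fact S3cop_is_additive : zmod_morphism S3cop.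
Proof. exact: (pliftB (@tconstC C S3 S3) S3cop_rel). Qed.

Fact S3cop_is_monoid : monoid_morphism S3cop.
Proof. exact: (pliftM (@tconstC C S3 S3) S3cop_rel). Qed.

HB.instance Definition _ :=
  GRing.isZmodMorphism.Build S3 (S3 \ox S3)%type S3cop S3cop_is_additive.
HB.instance Definition _ :=
  GRing.isMonoidMorphism.Build S3 (S3 \ox S3)%type S3cop S3cop_is_monoid.

Lemma S3cop_of x : S3cop (S3of x) = S3cop_gen x.
Proof. exact: (plift_gen (@tconstC C S3 S3) S3cop_rel). Qed.

End QuantumSphere.

Section QuantumEnvelopingAlgebra.
Variables (R : realType) (q : qparam R).
Notation C := R[i].
Notation qq := (qC q).

(* GKi stands for K^-1. *)
Inductive Ugen := GE | GF | GK | GKi.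

Local Notation "''E'" := (FGen GE) : fterm_scope.
Local Notation "''F'" := (FGen GF) : fterm_scope.
Local Notation "''K'" := (FGen GK) : fterm_scope.
Local Notation "''Ki'" := (FGen GKi) : fterm_scope.

Inductive Urel : fterm C Ugen -> fterm C Ugen -> Prop :=
| Urel_KKi : Urel ('K * 'Ki)%F 1%:F
| Urel_KiK : Urel ('Ki * 'K)%F 1%:F
| Urel_KE : Urel ('K * 'E)%F (qq%:F * ('E * 'K))%F
| Urel_KiE : Urel ('Ki * 'E)%F (qq^-1%:F * ('E * 'Ki))%F
| Urel_KF : Urel ('K * 'F)%F (qq^-1%:F * ('F * 'K))%F
| Urel_KiF : Urel ('Ki * 'F)%F (qq%:F * ('F * 'Ki))%F
| Urel_EF : Urel ('E * 'F + (-1)%:F * ('F * 'E))%F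
    ((qq - qq^-1)^-1%:F * ('K * 'K + (-1)%:F * ('Ki * 'Ki)))%F.

Definition Ucounit_gen (x : Ugen) : C :=
  match x with GE | GF => 0 | GK | GKi => 1 end.

Lemma Ucounit_rel x y : Urel x y ->
  feval (idfun : {rmorphism C -> C}) Ucounit_gen x =
  feval (idfun : {rmorphism C -> C}) Ucounit_gen y.
Proof.
by case=> /=; rewrite ?(mulr0, mul0r, mulr1, mul1r, addr0, subrr).
Qed.

Definition Uq : Type := presented Urel.
HB.instance Definition _ := GRing.PzRing.on Uq.
HB.instance Definition _ := GRing.Lmodule.copy Uq (presented Urel).

Definition Ucounit (u : Uq) : C :=
  plift (idfun : {rmorphism C -> C}) Ucounit_gen u.

Fact Uq_oner_neq0 : (1 : Uq) != 0.
Proof.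
have embC (k x : C) : (idfun : {rmorphism C -> C}) k * x = x * idfun k.
  exact: mulrC.
have [h1 _] := pliftM embC Ucounit_rel.
apply/eqP => e; move: (pliftB embC Ucounit_rel 0 0).
rewrite subrr subrr -[X in plift _ _ X]e h1 => /eqP.
by rewrite oner_eq0.
Qed.

HB.instance Definition _ :=
  GRing.PzSemiRing_isNonZero.Build Uq Uq_oner_neq0.
HB.instance Definition _ :=
  GRing.Lmodule_isLalgebra.Build C Uq (@presented_scalerAl C Ugen Urel).
HB.instance Definition _ :=
  GRing.Lalgebra_isAlgebra.Build C Uq (@presented_scalerAr C Ugen Urel).

Definition Uof (x : Ugen) : Uq := pgen Urel x.

Local Notation E := (Uof GE).
Local Notation F := (Uof GF).
Local Notation K := (Uof GK).
Local Notation Ki := (Uof GKi).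

Let UrelE x y : Urel x y -> pclass Urel x = pclass Urel y.
Proof. by move=> h; apply/pclassP/fcong_rel. Qed.

Lemma U_KKi : K * Ki = 1.
Proof. by have := UrelE Urel_KKi; rewrite pclassM pclassC scale1r. Qed.

Lemma U_KiK : Ki * K = 1.
Proof. by have := UrelE Urel_KiK; rewrite pclassM pclassC scale1r. Qed.

Lemma U_KE : K * E = qq *: (E * K).
Proof. by have := UrelE Urel_KE; rewrite pclassZ !pclassM. Qed.

Lemma U_KiE : Ki * E = qq^-1 *: (E * Ki).
Proof. by have := UrelE Urel_KiE; rewrite pclassZ !pclassM. Qed.

Lemma U_KF : K * F = qq^-1 *: (F * K).
Proof. by have := UrelE Urel_KF; rewrite pclassZ !pclassM. Qed.

Lemma U_KiF : Ki * F = qq *: (F * Ki).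
Proof. by have := UrelE Urel_KiF; rewrite pclassZ !pclassM. Qed.

Lemma U_EF : E * F - F * E = (qq - qq^-1)^-1 *: (K ^+ 2 - Ki ^+ 2).
Proof.
have := UrelE Urel_EF; rewrite !(pclassD, pclassZ, pclassM) !scaleN1r.
by rewrite !expr2.
Qed.

Definition Ucop_gen (x : Ugen) : Uq \ox Uq :=
  match x with
  | GE => E \ox K + Ki \ox E
  | GF => F \ox K + Ki \ox F
  | GK => K \ox K
  | GKi => Ki \ox Ki
  end.

Definition Ucop (u : Uq) : Uq \ox Uq :=
  plift (@tconst C Uq Uq : {rmorphism C -> Uq \ox Uq}) Ucop_gen u.

Lemma Ucop_rel x y : Urel x y ->
  feval (@tconst C Uq Uq) Ucop_gen x = feval (@tconst C Uq Uq) Ucop_gen y.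
Proof.
have U_EF2 : E * F - F * E = (qq - qq^-1)^-1 *: (K * K - Ki * Ki).
  by rewrite U_EF !expr2.
have [[h1 h2] [h3 h4] [h5 h6] h7] := enveloping_coproduct_relations
  (qC_neq0 q) U_KKi U_KiK U_KE U_KiE U_KF U_KiF U_EF2.
by case; rewrite /= ?tconstE ?rmorph1 // !scaleN1r.
Qed.

Fact Ucop_is_additive : zmod_morphism Ucop.
Proof. exact: (pliftB (@tconstC C Uq Uq) Ucop_rel). Qed.

Fact Ucop_is_monoid : monoid_morphism Ucop.
Proof. exact: (pliftM (@tconstC C Uq Uq) Ucop_rel). Qed.

HB.instance Definition _ :=
  GRing.isZmodMorphism.Build Uq (Uq \ox Uq)%type Ucop Ucop_is_additive.
HB.instance Definition _ :=
  GRing.isMonoidMorphism.Build Uq (Uq \ox Uq)%type Ucop Ucop_is_monoid.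

Lemma Ucop_of x : Ucop (Uof x) = Ucop_gen x.
Proof. exact: (plift_gen (@tconstC C Uq Uq) Ucop_rel). Qed.

End QuantumEnvelopingAlgebra.

Section HopfPairing.
Variables (R : realType) (q : qparam R).
Notation C := R[i].

Definition pairing_gen (x : Ugen) (y : S3gen) : C :=
  match x, y with
  | GK, Ga | GKi, Gas => (sqrtq q)^-1
  | GK, Gas | GKi, Ga => sqrtq q
  | GE, Gc => 1
  | GF, Gcs => - (qC q)^-1
  | _, _ => 0
  end.

(* Compatibility with the antipodes follows from these identities. *)
Record hopf_pairing := HopfPairing {
  pairing :> Uq q -> S3 q -> C;
  pairing_linl : forall f, scalar (pairing^~ f);
  pairing_linr : forall u, scalar (pairing u);
  pairing_mull : forall u v f,
    pairing (u * v) f = sweedler (fun f1 f2 => pairing u f1 * pairing v f2) (S3cop f);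
  pairing_mulr : forall u f g,
    pairing u (f * g) = sweedler (fun u1 u2 => pairing u1 f * pairing u2 g) (Ucop u);
  pairing_1l : forall f, pairing 1 f = S3counit f;
  pairing_1r : forall u, pairing u 1 = Ucounit u;
  pairing_of : forall x y, pairing (Uof q x) (S3of q y) = pairing_gen x y
}.

Inductive side := LeftAction | RightAction.

Definition action (pr : hopf_pairing) (s : side) (u : Uq q) (f : S3 q) : S3 q :=
  match s with
  | LeftAction => sweedler (fun f1 f2 => pr u f2 *: f1) (S3cop f)
  | RightAction => sweedler (fun f1 f2 => pr u f1 *: f2) (S3cop f)
  end.

Local Notation E := (Uof q GE).
Local Notation F := (Uof q GF).
Local Notation K := (Uof q GK).
Local Notation Ki := (Uof q GKi).

(* Indices 0, 1, 2 of 'I_3 stand for 1 = +, 2 = -, 3 = z. *)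
Definition Xelt (a : 'I_3) : Uq q :=
  tnth [tuple sqrtq q *: (E * K);
              (sqrtq q)^-1 *: (F * K);
              (1 - qC q ^- 2)^-1 *: (1 - K ^+ 4)] a.

Definition sigma_elt (a : 'I_3) : Uq q := tnth [tuple K ^+ 2; K ^+ 2; K ^+ 4] a.

Definition sigmas_elt (a : 'I_3) : Uq q :=
  tnth [tuple Ki ^+ 2; Ki ^+ 2; Ki ^+ 4] a.

Variables (pr : hopf_pairing) (s : side).

Definition sigma a : S3 q -> S3 q := action pr s (sigma_elt a).
Definition sigmas a : S3 q -> S3 q := action pr s (sigmas_elt a).

Definition starop (X : S3 q -> S3 q) : S3 q -> S3 q :=
  fun f => S3star (X (S3star f)).

Definition X_ a : S3 q -> S3 q := action pr s (Xelt a).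
Definition Xs_ a : S3 q -> S3 q := starop (X_ a).

(* The tangent space is the span of the X_a and X_a^* inside the complex
   vector space of maps from S3 to itself. *)
Definition in_tangent : {pred (S3 q -> S3 q)} := fun X =>
  `[< exists k l : 'I_3 -> C, X = \sum_a (k a *: X_ a + l a *: Xs_ a) >].

Fact in_tangent_submod : submod_closed in_tangent.
Proof.
split=> [|m X Y /asboolP[k [l ->]] /asboolP[k' [l' ->]]]; apply/asboolP.
  exists (fun=> 0), (fun=> 0); rewrite big1 // => a _.
  by rewrite !scale0r addr0.
exists (fun a => m * k a + k' a), (fun a => m * l a + l' a).
rewrite scaler_sumr -big_split; apply: eq_bigr => a _ /=.
by rewrite !scalerDl scalerDr !scalerA addrACA.
Qed.

HB.instance Definition _ :=
  GRing.isSubmodClosed.Build C (S3 q -> S3 q) in_tangent in_tangent_submod.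

Record tangent := Tangent { tval :> S3 q -> S3 q; tvalP : in_tangent tval }.

HB.instance Definition _ := [isSub for tval].
HB.instance Definition _ := [Choice of tangent by <:].
HB.instance Definition _ := [SubChoice_isSubLmodule of tangent by <:].

Fact X_tangent a : in_tangent (X_ a).
Proof.
apply/asboolP; exists (fun b => (b == a)%:R), (fun=> 0).
rewrite (bigD1 a) //= eqxx scale1r scale0r addr0 big1 ?addr0 // => b /negPf ->.
by rewrite !scale0r addr0.
Qed.

Fact Xs_tangent a : in_tangent (Xs_ a).
Proof.
apply/asboolP; exists (fun=> 0), (fun b => (b == a)%:R).
rewrite (bigD1 a) //= eqxx scale1r scale0r add0r big1 ?addr0 // => b /negPf ->.
by rewrite !scale0r addr0.
Qed.

Definition TX a : tangent := Tangent (X_tangent a).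
Definition TXs a : tangent := Tangent (Xs_tangent a).

(* A left S3-module is a complex vector space through k |-> k *: 1. *)
Definition Clinear (M N : lmodType (S3 q)) (h : M -> N) : Prop :=
  forall (k : C) (m m' : M), h (k%:A *: m + m') = k%:A *: h m + h m'.

(* hs a and hss a are hat sigma_a and hat sigma_a^*. *)
Record is_sigma_module (M : lmodType (S3 q)) (hs hss : 'I_3 -> M -> M) : Prop := {
  hsigma_linear : forall a, Clinear (hs a);
  hsigmas_linear : forall a, Clinear (hss a);
  hsigmaZ : forall a f m, hs a (f *: m) = sigma a f *: hs a m;
  hsigmasZ : forall a f m, hss a (f *: m) = sigmas a f *: hss a m
}.

Record is_affine_connection (M : lmodType (S3 q)) (hs : 'I_3 -> M -> M)
    (nabla : tangent -> M -> M) : Prop := {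
  nabla_linearl : forall (k : C) (X Y : tangent) m,
    nabla (k *: X + Y) m = k%:A *: nabla X m + nabla Y m;
  nabla_linearr : forall X, Clinear (nabla X);
  nabla_X : forall a f m,
    nabla (TX a) (f *: m) = f *: nabla (TX a) m + X_ a f *: hs a m;
  nabla_Xs : forall a f m,
    nabla (TXs a) (f *: m) = sigmas a f *: nabla (TXs a) m + Xs_ a f *: m
}.

End HopfPairing.

Section Image.
Variables (A : pzRingType) (V W : lmodType A) (p : {linear V -> W}).

Definition in_image : {pred W} := fun w => `[< exists v, w = p v >].

Fact in_image_submod : submod_closed in_image.
Proof.
split=> [|k w w' /asboolP[v ->] /asboolP[v' ->]]; apply/asboolP.
  by exists 0; rewrite linear0.
by exists (k *: v + v'); rewrite linearP.
Qed.

HB.instance Definition _ :=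
  GRing.isSubmodClosed.Build A W in_image in_image_submod.

Record image_mod := ImageMod { ival :> W; ivalP : in_image ival }.

HB.instance Definition _ := [isSub for ival].
HB.instance Definition _ := [Choice of image_mod by <:].
HB.instance Definition _ := [SubChoice_isSubLmodule of image_mod by <:].

Fact in_imageP v : in_image (p v).
Proof. by apply/asboolP; exists v. Qed.

Definition to_image (v : V) : image_mod := ImageMod (in_imageP v).

End Image.

(* Main.v *)
Require Import Defs.
From mathcomp Require Import all_boot all_order all_algebra.
From mathcomp Require Import reals.

Import GRing.Theory Num.Theory.
Local Open Scope ring_scope.

(** On their right-hand sides, the identities that define a sigma-module and an
    affine connection are left linear combinations of the values of the maps,
    and so they survive composition with the left linear map [p].  The single
    exception is the term [Xs_ a f *: m] in the Leibniz rule of X_a^*, which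
    contains the argument itself.  Composition turns it into [Xs_ a f *: p m],
    and this is where idempotence enters: [p] is the identity on its image
    ([idempotent_image]). *)

Section Corestriction.
Variables (A : pzRingType) (V W : lmodType A) (p : {linear V -> W}).

Lemma ival_linear (k : A) (m m' : image_mod p) :
  ival (k *: m + m') = k *: ival m + ival m'.
Proof. by []. Qed.

Lemma ivalZ (k : A) (m : image_mod p) : ival (k *: m) = k *: ival m.
Proof. by []. Qed.

Lemma to_imageD (v w : V) : to_image p (v + w) = to_image p v + to_image p w.
Proof. by apply/val_inj; rewrite /= linearD. Qed.

Lemma to_imageZ (k : A) (v : V) : to_image p (k *: v) = k *: to_image p v.
Proof. by apply/val_inj; rewrite /= linearZ. Qed.

End Corestriction.

(** An element of the image is some [p v], and [p (p v) = p v]. *)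
Lemma idempotent_image (A : pzRingType) (V : lmodType A) (p : {linear V -> V}) :
  (forall v, p (p v) = p v) -> forall m : image_mod p, to_image p (ival m) = m.
Proof.
by move=> pp m; apply/val_inj => /=; case: m => m /= /boolp.asboolP[v ->].
Qed.

Theorem proposition3p7 (R : realType) (q : qparam R)
    (pr : hopf_pairing q) (s : side) (n : nat)
    (hs0 hss0 : 'I_3 -> 'rV[S3 q]_n -> 'rV[S3 q]_n)
    (nabla0 : tangent pr s -> 'rV[S3 q]_n -> 'rV[S3 q]_n)
    (p : {linear 'rV[S3 q]_n -> 'rV[S3 q]_n}) :
  is_sigma_module pr s hs0 hss0 ->
  is_affine_connection hs0 nabla0 ->
  (forall m, p (p m) = p m) ->
  let hs (a : 'I_3) (m : image_mod p) := to_image p (hs0 a (ival m)) in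
  let hss (a : 'I_3) (m : image_mod p) := to_image p (hss0 a (ival m)) in
  let nabla (X : tangent pr s) (m : image_mod p) :=
    to_image p (nabla0 X (ival m)) in
  is_sigma_module pr s hs hss /\ is_affine_connection hs nabla.
Proof.
move=> [hs_lin hss_lin hsZ hssZ] [nabX nabm nab_X nab_Xs] pp hs hss nabla.
split; split.
- by move=> a k m m'; rewrite /hs ival_linear hs_lin to_imageD to_imageZ.
- by move=> a k m m'; rewrite /hss ival_linear hss_lin to_imageD to_imageZ.
- by move=> a f m; rewrite /hs ivalZ hsZ to_imageZ.
- by move=> a f m; rewrite /hss ivalZ hssZ to_imageZ.
- by move=> k X Y m; rewrite /nabla nabX to_imageD to_imageZ.
- by move=> X k m m'; rewrite /nabla ival_linear nabm to_imageD to_imageZ.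
- by move=> a f m; rewrite /nabla /hs ivalZ nab_X to_imageD !to_imageZ.
- move=> a f m; rewrite /nabla ivalZ nab_Xs to_imageD !to_imageZ.
  by rewrite idempotent_image.
Qed.
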